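(* Let $\rho_0\in\mathcal P_2(\mathbb R^d)$, $\mathbb H:=L^2(\mathbb R^d;\rho_0)$, and let $\phi:\mathcal P_2(\mathbb R^d)\to\mathbb R$ be such that the lift $\phi^{\#}_{\rho_0}$ is Fréchet differentiable on $\mathbb H$, bounded, with bounded gradient, and with globally Lipschitz gradient, with Lipschitz constant \[L(\phi):=\sup_{\xi_1\neq\xi_2\in\mathbb H}\frac{\|\nabla\phi^{\#}_{\rho_0}(\xi_1)-\nabla\phi^{\#}_{\rho_0}(\xi_2)\|_{\mathbb H}}{\|\xi_1-\xi_2\|_{\mathbb H}}\in(0,\infty).\] Let $X:[0,\infty)\to\mathbb H$ be the unique $C^1$ solution of $\dot X(t)=-\nabla\phi^{\#}_{\rho_0}(X(t))$, $X(0)=\mathrm{Id}$. Fix $T>0$ and $\alpha\in(0,1]$, and assume that $t\mapsto\dot X(t)$ is Fréchet differentiable from $[0,T]$ to $\mathbb H$ with derivative $\ddot X$ and that \[L_\alpha(T,\ddot X):=\sup_{t\neq s\in[0,T]}\frac{\|\dot X(t)-\dot X(s)-(t-s)\ddot X(s)\|_{\mathbb H}}{|t-s|^{1+\alpha}}<\infty.\] Let $0<\tau\le 1/L(\phi)$, let $X_0^\tau\in\mathbb H$, and let $(X_n^\tau)_{n\ge0}$ be the iterates of the Lagrangian trapezoidal scheme (which are well defined and unique under these hypotheses). Then for every $n\in\mathbb N$ with $n\tau\le T$, \[W_2\big((X(n\tau))_{\#}\rho_0,(X_n^\tau)_{\#}\rho_0\big)\le\|X_n^\tau-X(n\tau)\|_{\mathbb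 H}\le e^{2L(\phi)T}\|X_0^\tau-\mathrm{Id}\|_{\mathbb H}+2\frac{L_\alpha(T,\ddot X)}{L(\phi)}\big(e^{2L(\phi)T}-1\big)\tau^{1+\alpha}.\]
   Context: $\mathcal P_2(\mathbb R^d)$ is the set of Borel probability measures on $\mathbb R^d$ with finite second moment and $W_2$ the quadratic Wasserstein distance. For $\rho_0\in\mathcal P_2(\mathbb R^d)$, $\mathbb H=L^2(\mathbb R^d;\rho_0)$ is the Hilbert space of ($\rho_0$-a.e. classes of) Borel maps $\xi:\mathbb R^d\to\mathbb R^d$ with $\int|\xi|^2d\rho_0<\infty$, inner product $\langle\xi_1,\xi_2\rangle_{\mathbb H}=\int\langle\xi_1(x),\xi_2(x)\rangle d\rho_0(x)$; $\mathrm{Id}$ is the identity map. For $\phi:\mathcal P_2(\mathbb R^d)\to\mathbb R$ the lift is $\phi^{\#}_{\rho_0}:\mathbb H\to\mathbb R$, $\phi^{\#}_{\rho_0}(\xi):=\phi(\xi_{\#}\rho_0)$, and $\nabla\phi^{\#}_{\rho_0}(\xi)\in\mathbb H$ denotes its Fréchet gradient. Lagrangian trapezoidal scheme: given $X_0^\tau\in\mathbb H$, for $n\ge0$, \[X_{n+1}^\tau\in\arg\min_{\xi\in\mathbb H}\Big\{\tfrac12\phi^{\#}_{\rho_0}(\xi)+\tfrac12\langle\nabla\phi^{\#}_{\rho_0}(X_n^\tau),\xi\rangle_{\mathbb H}+\tfrac1{2\tau}\|\xi-X_n^\tau\|_{\mathbb H}^2\Big\}.\] *)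

(* Defs.v *)
(* R^d is modelled as (dim.-tuple R) with the
   product (= Borel) sigma-algebra provided by mathcomp-analysis. *)
From HB Require Import structures.
From mathcomp Require Import all_boot all_order all_algebra.
From mathcomp Require Import all_classical all_reals all_analysis.
Set Implicit Arguments. Unset Strict Implicit. Unset Printing Implicit Defensive.
Import Order.TTheory GRing.Theory Num.Theory numFieldNormedType.Exports.
Local Open Scope classical_set_scope.
Local Open Scope ring_scope.

Section Defs.
Variables (R : realType) (dim : nat).
Notation Rd := (dim.-tuple R).

Definition dotv (x y : Rd) : R := \sum_(i < dim) tnth x i * tnth y i.
Definition normv (x : Rd) : R := Num.sqrt (dotv x x).
Definition addv (x y : Rd) : Rd := [tuple tnth x i + tnth y i | i < dim].
Definition oppv (x : Rd) : Rd := [tuple - tnth x i | i < dim].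
Definition subv (x y : Rd) : Rd := addv x (oppv y).
Definition scalev (a : R) (x : Rd) : Rd := [tuple a * tnth x i | i < dim].

Definition fadd (f g : Rd -> Rd) : Rd -> Rd := fun x => addv (f x) (g x).
Definition fopp (f : Rd -> Rd) : Rd -> Rd := fun x => oppv (f x).
Definition fsub (f g : Rd -> Rd) : Rd -> Rd := fun x => subv (f x) (g x).
Definition fscale (a : R) (f : Rd -> Rd) : Rd -> Rd := fun x => scalev a (f x).

Variable rho0 : probability Rd R.

Definition P2 : Prop := (\int[rho0]_x ((normv x) ^+ 2)%:E < +oo)%E.

(* membership in H = L^2(R^dim; rho0) (representatives) *)
Definition inH (xi : Rd -> Rd) : Prop :=
  measurable_fun [set: Rd] xi /\ (\int[rho0]_x ((normv (xi x)) ^+ 2)%:E < +oo)%E.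

Definition innerH (xi1 xi2 : Rd -> Rd) : R :=
  Rintegral rho0 [set: Rd] (fun x => dotv (xi1 x) (xi2 x)).
Definition normH (xi : Rd -> Rd) : R :=
  Num.sqrt (Rintegral rho0 [set: Rd] (fun x => (normv (xi x)) ^+ 2)).

Definition philift (phi : (set Rd -> \bar R) -> R) (xi : Rd -> Rd) : R :=
  phi (pushforward rho0 xi).

Definition is_gradH (F : (Rd -> Rd) -> R) (G : (Rd -> Rd) -> (Rd -> Rd)) : Prop :=
  forall xi, inH xi ->
    inH (G xi) /\
    forall eps : R, 0 < eps -> exists2 delta : R, 0 < delta &
      forall h, inH h -> normH h < delta ->
        `| F (fadd xi h) - F xi - innerH (G xi) h | <= eps * normH h.

Definition lip_quotients (G : (Rd -> Rd) -> (Rd -> Rd)) : set R :=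
  [set r | exists xi1 xi2, [/\ inH xi1, inH xi2, normH (fsub xi1 xi2) != 0 &
     r = normH (fsub (G xi1) (G xi2)) / normH (fsub xi1 xi2)]].
Definition lipL (G : (Rd -> Rd) -> (Rd -> Rd)) : R := sup (lip_quotients G).

Definition derivH_within (D : set R) (Y V : R -> (Rd -> Rd)) (t : R) : Prop :=
  forall eps : R, 0 < eps -> exists2 delta : R, 0 < delta &
    forall s, D s -> 0 < `|s - t| < delta ->
      normH (fsub (fsub (Y s) (Y t)) (fscale (s - t) (V t))) <= eps * `|s - t|.

Definition contH_within (D : set R) (Y : R -> (Rd -> Rd)) (t : R) : Prop :=
  forall eps : R, 0 < eps -> exists2 delta : R, 0 < delta &
    forall s, D s -> `|s - t| < delta -> normH (fsub (Y s) (Y t)) <= eps.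

Definition holder_quotients (T alpha : R) (Xd Xdd : R -> (Rd -> Rd)) : set R :=
  [set r | exists t s, [/\ 0 <= t <= T, 0 <= s <= T, t != s &
     r = normH (fsub (fsub (Xd t) (Xd s)) (fscale (t - s) (Xdd s)))
         / (`|t - s| `^ (1 + alpha))]].
Definition LalphaC (T alpha : R) (Xd Xdd : R -> (Rd -> Rd)) : R :=
  sup (holder_quotients T alpha Xd Xdd).

Definition trap_obj (F : (Rd -> Rd) -> R) (G : (Rd -> Rd) -> (Rd -> Rd))
  (tau : R) (Xn xi : Rd -> Rd) : R :=
  F xi / 2 + innerH (G Xn) xi / 2 + (normH (fsub xi Xn)) ^+ 2 / (2 * tau).

Definition trap_iterates (F : (Rd -> Rd) -> R) (G : (Rd -> Rd) -> (Rd -> Rd))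
  (tau : R) (Xs : nat -> (Rd -> Rd)) : Prop :=
  inH (Xs 0%N) /\
  forall k : nat, inH (Xs k.+1) /\
    forall xi, inH xi -> trap_obj F G tau (Xs k) (Xs k.+1) <= trap_obj F G tau (Xs k) xi.

End Defs.

Definition is_coupling (R : realType) (dim : nat)
  (mu nu : set (dim.-tuple R) -> \bar R)
  (gamma : probability (dim.-tuple R * dim.-tuple R)%type R) : Prop :=
  forall A : set (dim.-tuple R), measurable A ->
    gamma (fst @^-1` A) = mu A /\ gamma (snd @^-1` A) = nu A.

Definition W2 (R : realType) (dim : nat) (mu nu : set (dim.-tuple R) -> \bar R) : R :=
  Num.sqrt (fine (ereal_inf
    [set c | exists2 gamma, is_coupling mu nu gamma &
       c = (\int[gamma]_z ((normv (subv z.1 z.2)) ^+ 2)%:E)%E])).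

(* Main.v *)
From Pilot Require Import Defs.
From HB Require Import structures.
From mathcomp Require Import all_boot all_order all_algebra.
From mathcomp Require Import all_classical all_reals all_analysis.
From mathcomp Require Import measurable_realfun ring lra.
(* [vector] exports other constants named [addv] and [subv]. *)
Import Pilot.Defs.
Import Order.TTheory GRing.Theory Num.Theory numFieldNormedType.Exports.
Local Open Scope classical_set_scope.
Local Open Scope ring_scope.

(** Write [e n] for the distance in [H] between the [n]-th iterate and the
    exact solution at time [n * tau], and [L] for the Lipschitz constant of the
    gradient.  Minimality of the iterates gives the trapezoidal rule
    [X_(n+1) - X_n + tau / 2 (G X_(n+1) + G X_n) = 0], while the exact solution
    satisfies the same rule up to a defect.  Subtracting the second-order Taylor
    polynomial of [X] at the left endpoint leaves a curve whose velocity has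
    norm at most [L_alpha tau ^ (1 + alpha)], so by the mean value inequality the
    defect is at most [3 / 2 L_alpha tau ^ (2 + alpha)].  Hence, with
    [a = tau L <= 1],
    [(1 - a / 2) e (n+1) <= (1 + a / 2) e n + 3 / 2 L_alpha tau ^ (2 + alpha)],
    and a discrete Gronwall argument with growth factor
    [1 + 2 a <= exp (2 tau L)] concludes.  The bound on [W2] comes from the
    coupling of the two push-forwards by the pair of maps. *)

(** * Coordinates of vectors and of maps *)

Section Coordinates.
Context {R : realType} {dim : nat}.
Implicit Types (x y : dim.-tuple R) (f g : dim.-tuple R -> dim.-tuple R).

Lemma tnth_addv x y i : tnth (addv x y) i = tnth x i + tnth y i.
Proof. exact: tnth_mktuple. Qed.

Lemma tnth_oppv x i : tnth (oppv x) i = - tnth x i.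
Proof. exact: tnth_mktuple. Qed.

Lemma tnth_subv x y i : tnth (subv x y) i = tnth x i - tnth y i.
Proof. by rewrite tnth_addv tnth_oppv. Qed.

Lemma tnth_scalev a x i : tnth (scalev a x) i = a * tnth x i.
Proof. exact: tnth_mktuple. Qed.

Lemma tnth_fadd f g x i : tnth (fadd f g x) i = tnth (f x) i + tnth (g x) i.
Proof. exact: tnth_addv. Qed.

Lemma tnth_fopp f x i : tnth (fopp f x) i = - tnth (f x) i.
Proof. exact: tnth_oppv. Qed.

Lemma tnth_fsub f g x i : tnth (fsub f g x) i = tnth (f x) i - tnth (g x) i.
Proof. exact: tnth_subv. Qed.

Lemma tnth_fscale a f x i : tnth (fscale a f x) i = a * tnth (f x) i.
Proof. exact: tnth_scalev. Qed.

Definition tnth_mapE := (tnth_fadd, tnth_fopp, tnth_fsub, tnth_fscale).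

End Coordinates.

(** Linear identities between maps reduce, point by point and coordinate by coordinate, to ring
    identities in [R]. *)
Ltac map_ring :=
  by apply/funext => ?; apply: eq_from_tnth => ?; rewrite !tnth_mapE; ring.

(** * Square-integrable maps, their inner product, and the coupling bound on [W2] *)

Section SquareIntegrableMaps.
Context {R : realType} {dim : nat} (rho0 : probability (dim.-tuple R) R).
Implicit Types (x y z : dim.-tuple R) (f g h : dim.-tuple R -> dim.-tuple R).

Lemma dotvC x y : dotv x y = dotv y x.
Proof. by apply: eq_bigr => i _; rewrite mulrC. Qed.

Lemma dotvDl x y z : dotv (addv x y) z = dotv x z + dotv y z.
Proof.
by rewrite -big_split; apply: eq_bigr => i _; rewrite tnth_addv mulrDl.
Qed.

Lemma dotvZl a x y : dotv (scalev a x) y = a * dotv x y.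
Proof.
by rewrite mulr_sumr; apply: eq_bigr => i _; rewrite tnth_scalev mulrA.
Qed.

Lemma dotvv_ge0 x : 0 <= dotv x x.
Proof. by apply: sumr_ge0 => i _; rewrite -expr2 sqr_ge0. Qed.

Lemma normv_sqr x : normv x ^+ 2 = dotv x x.
Proof. by rewrite sqr_sqrtr// dotvv_ge0. Qed.

Lemma normr_dotv_le x y : `|dotv x y| <= dotv x x + dotv y y.
Proof.
rewrite -big_split /=; apply: le_trans (ler_norm_sum _ _ _) _.
apply: ler_sum => i _; set a := tnth x i; set b := tnth y i.
have := sqr_ge0 (a + b); have := sqr_ge0 (a - b).
have := sqr_ge0 a; have := sqr_ge0 b.
by rewrite ler_norml => *; apply/andP; split; lra.
Qed.

Lemma measurable_dotv f g : measurable_fun setT f -> measurable_fun setT g ->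
  measurable_fun setT (fun x => dotv (f x) (g x)).
Proof.
move=> /measurable_fun_tnthP mf /measurable_fun_tnthP mg.
by apply: measurable_sum => i; apply: measurable_funM; [exact: mf|exact: mg].
Qed.

(** The integrand is nonnegative, so a finite integral amounts to integrability; this form gives
    access to linearity and domination. *)
Lemma inHP f : inH rho0 f <-> measurable_fun setT f /\
  rho0.-integrable setT (EFin \o (fun x => dotv (f x) (f x))).
Proof.
have normE : (\int[rho0]_x `|(dotv (f x) (f x))%:E| =
    \int[rho0]_x (normv (f x) ^+ 2)%:E)%E.
  by apply: eq_integral => x _; rewrite normv_sqr /= ger0_norm// dotvv_ge0.
split=> -[mf If]; split => //; last by case/integrableP: If; rewrite normE.
apply/integrableP; rewrite normE; split => //.
by apply/measurable_EFinP; exact: measurable_dotv.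
Qed.

(** Domination by [|f|^2 + |g|^2]. *)
Lemma inH_integrable f g : inH rho0 f -> inH rho0 g ->
  rho0.-integrable setT (EFin \o (fun x => dotv (f x) (g x))).
Proof.
move=> /inHP[mf If] /inHP[mg Ig].
apply: (le_integrable _ _ _ (integrableD _ If Ig)) => //.
  by apply/measurable_EFinP; exact: measurable_dotv.
move=> x _; rewrite /= lee_fin; apply: le_trans (normr_dotv_le _ _) _.
by rewrite ger0_norm// addr_ge0// dotvv_ge0.
Qed.

Lemma inH_scale a f : inH rho0 f -> inH rho0 (fscale a f).
Proof.
move=> Hf; have [mf If] := (inHP f).1 Hf; apply/inHP; split.
  apply/measurable_fun_tnthP => i; move/measurable_fun_tnthP/(_ i): mf => mf.
  rewrite (_ : _ \o _ = (fun x => a * tnth (f x) i)); last first.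
    by apply/funext => x /=; rewrite tnth_scalev.
  exact: measurable_funM.
rewrite (_ : _ \o _ = (fun x => (a ^+ 2)%:E * (dotv (f x) (f x))%:E)%E).
  exact: integrableZl.
by apply/funext => x /=; rewrite dotvZl dotvC dotvZl mulrA.
Qed.

Lemma inH_add f g : inH rho0 f -> inH rho0 g -> inH rho0 (fadd f g).
Proof.
move=> Hf Hg; have [mf If] := (inHP f).1 Hf; have [mg Ig] := (inHP g).1 Hg.
apply/inHP; split.
  apply/measurable_fun_tnthP => i.
  move/measurable_fun_tnthP/(_ i): mf => mf.
  move/measurable_fun_tnthP/(_ i): mg => mg.
  rewrite (_ : _ \o _ = (fun x => tnth (f x) i + tnth (g x) i)); last first.
    by apply/funext => x /=; rewrite tnth_addv.
  exact: measurable_funD.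
pose dE (u v : dim.-tuple R -> dim.-tuple R) :=
  EFin \o (fun x => dotv (u x) (v x)).
rewrite (_ : _ \o _ = ((dE f f \+ dE g f) \+ (dE f g \+ dE g g))%E).
  by apply: integrableD => //; apply: integrableD => //; exact: inH_integrable.
apply/funext => x /=; rewrite -!EFinD dotvDl !(dotvC _ (addv _ _)) !dotvDl.
by congr EFin; rewrite (dotvC (f x) (g x)); ring.
Qed.

Lemma foppE f : fopp f = fscale (-1) f.
Proof.
by map_ring.
Qed.

Lemma fsubE f g : fsub f g = fadd f (fscale (-1) g).
Proof.
by map_ring.
Qed.

Lemma inH_opp f : inH rho0 f -> inH rho0 (fopp f).
Proof. by rewrite foppE; exact: inH_scale. Qed.

Lemma inH_sub f g : inH rho0 f -> inH rho0 g -> inH rho0 (fsub f g).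
Proof. by rewrite fsubE => Hf Hg; apply/inH_add/inH_scale. Qed.

Lemma innerHC f g : innerH rho0 f g = innerH rho0 g f.
Proof. by apply: eq_Rintegral => x _; exact: dotvC. Qed.

Lemma innerHDl f g h : inH rho0 f -> inH rho0 g -> inH rho0 h ->
  innerH rho0 (fadd f g) h = innerH rho0 f h + innerH rho0 g h.
Proof.
move=> Hf Hg Hh; rewrite -RintegralD//; try exact: inH_integrable.
by apply: eq_Rintegral => x _; exact: dotvDl.
Qed.

Lemma innerHZl a f g : inH rho0 f -> inH rho0 g ->
  innerH rho0 (fscale a f) g = a * innerH rho0 f g.
Proof.
move=> Hf Hg; rewrite -RintegralZl//; try exact: inH_integrable.
by apply: eq_Rintegral => x _; exact: dotvZl.
Qed.

Lemma innerHBl f g h : inH rho0 f -> inH rho0 g -> inH rho0 h ->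
  innerH rho0 (fsub f g) h = innerH rho0 f h - innerH rho0 g h.
Proof.
move=> Hf Hg Hh; rewrite fsubE innerHDl ?innerHZl ?mulN1r//.
exact: inH_scale.
Qed.

Lemma normH_ge0 f : 0 <= normH rho0 f.
Proof. exact: sqrtr_ge0. Qed.

Lemma normH_sqr f : normH rho0 f ^+ 2 = innerH rho0 f f.
Proof.
rewrite sqr_sqrtr; last by apply: Rintegral_ge0 => x _; exact: sqr_ge0.
by apply: eq_Rintegral => x _; exact: normv_sqr.
Qed.

Lemma inH_id : P2 rho0 -> inH rho0 id.
Proof. by split => //; exact: measurable_id. Qed.

(** The law of [x |-> (f x, g x)] under [rho0] couples the two push-forwards, and its cost is the
    squared distance of [f] and [g] in H. *)
Lemma W2_pushforward_le f g : inH rho0 f -> inH rho0 g ->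
  W2 (pushforward rho0 f) (pushforward rho0 g) <= normH rho0 (fsub f g).
Proof.
move=> Hf Hg; have mf := Hf.1; have mg := Hg.1.
have [_ Ifg] := inH_sub _ _ Hf Hg.
have mfg : measurable_fun setT (fun x => (f x, g x)).
  exact: measurable_fun_pair.
pose fg : {mfun dim.-tuple R >-> (dim.-tuple R * dim.-tuple R)%type} :=
  HB.pack (fun x => (f x, g x)) (isMeasurableFun.Build _ _ _ _ _ mfg).
have cost_ge0 (z : dim.-tuple R * dim.-tuple R) :
  (0 <= (normv (subv z.1 z.2) ^+ 2)%:E)%E by rewrite lee_fin sqr_ge0.
have cost_fg : (\int[distribution rho0 fg]_z (normv (subv z.1 z.2) ^+ 2)%:E =
    \int[rho0]_x (normv (fsub f g x) ^+ 2)%:E)%E.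
  rewrite ge0_integral_distribution//.
  apply/measurable_EFinP; under eq_fun do rewrite normv_sqr.
  apply: measurable_sum => i; under eq_fun do rewrite tnth_subv.
  have mi j : measurable_fun setT
      (fun z : dim.-tuple R * dim.-tuple R => tnth (if j then z.1 else z.2) i).
    case: j; [exact: (measurableT_comp (measurable_tnth i) measurable_fst)|].
    exact: (measurableT_comp (measurable_tnth i) measurable_snd).
  by apply: measurable_funM; exact: measurable_funB (mi true) (mi false).
(* [fine] is monotone on finite values only: the infimum is nonnegative and below the finite cost of
   this coupling. *)
apply: ler_wsqrtr; apply: fine_le.
- rewrite ge0_fin_numE; last first.
    by apply: le_ereal_inf_tmp => _ [gamma _ ->]; exact: integral_ge0.
  apply: le_lt_trans Ifg; rewrite -cost_fg.
  by apply: ereal_inf_lbound; exists (distribution rho0 fg).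
- rewrite ge0_fin_numE//.
  by apply: integral_ge0 => x _; rewrite lee_fin sqr_ge0.
- rewrite -cost_fg.
  by apply: ereal_inf_lbound; exists (distribution rho0 fg).
Qed.

End SquareIntegrableMaps.

(** * Cauchy-Schwarz and triangle inequalities for the seminorm [normH] on representatives *)

Section SemiInnerProduct.
Context {R : realType} {dim : nat} (rho0 : probability (dim.-tuple R) R).
Implicit Types f g h : dim.-tuple R -> dim.-tuple R.

Lemma normHE f : normH rho0 f = Num.sqrt (innerH rho0 f f).
Proof. by rewrite -normH_sqr sqrtr_sqr ger0_norm// normH_ge0. Qed.

Lemma normHZ a f : inH rho0 f -> normH rho0 (fscale a f) = `|a| * normH rho0 f.
Proof.
move=> Hf; rewrite !normHE innerHZl//; last exact: inH_scale.
by rewrite innerHC innerHZl// mulrA -expr2 sqrtrM ?sqr_ge0// sqrtr_sqr.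
Qed.

Lemma normHD_sqr f g : inH rho0 f -> inH rho0 g ->
  normH rho0 (fadd f g) ^+ 2 =
  normH rho0 f ^+ 2 + 2 * innerH rho0 f g + normH rho0 g ^+ 2.
Proof.
move=> Hf Hg; have Hfg := inH_add _ _ _ Hf Hg.
rewrite !normH_sqr innerHDl// !(innerHC _ _ (fadd f g)) !innerHDl//.
by rewrite (innerHC _ g f); ring.
Qed.

(** Expand [|u f - v g|^2 >= 0] and choose [u] and [v]. *)
Lemma innerH_le f g : inH rho0 f -> inH rho0 g ->
  innerH rho0 f g <= normH rho0 f * normH rho0 g.
Proof.
move=> Hf Hg; set a := normH rho0 f; set b := normH rho0 g.
have a0 : 0 <= a := normH_ge0 _ f; have b0 : 0 <= b := normH_ge0 _ g.
have key u v : 0 <= u ^+ 2 * a ^+ 2 - 2 * (u * v * innerH rho0 f g)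
    + v ^+ 2 * b ^+ 2.
  have := sqr_ge0 (normH rho0 (fadd (fscale u f) (fscale (- v) g))).
  rewrite normHD_sqr ?normHZ//; try exact: inH_scale.
  rewrite innerHZl ?(innerHC _ f) ?innerHZl//; last exact: inH_scale.
  rewrite !exprMn !real_normK ?num_real// sqrrN -/a -/b (innerHC _ g).
  by move=> ?; lra.
have [I_le0|I_gt0] := lerP (innerH rho0 f g) 0.
  exact: le_trans I_le0 (mulr_ge0 a0 b0).
move: a0; rewrite le_eqVlt => /predU1P[a0|a_gt0].
  (* A map of norm 0 need not be the zero map. Here [key u 1] forces [b ^+ 2 <= 0], and then
     [key 1 1] contradicts [I_gt0]. *)
  have [u uI] : exists u, u * innerH rho0 f g = b ^+ 2.
    by exists (b ^+ 2 / innerH rho0 f g); rewrite divfK// gt_eqF.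
  have := key u 1; rewrite -a0; have := key 1 1; rewrite -a0; lra.
rewrite -ler_sqr ?nnegrE; [|exact: ltW|exact/mulr_ge0/b0/ltW].
have := key (innerH rho0 f g) (a ^+ 2).
rewrite (_ : _ - _ + _ = a ^+ 2 * ((a * b) ^+ 2 - innerH rho0 f g ^+ 2)).
  by rewrite pmulr_rge0 ?exprn_gt0// subr_ge0.
by ring.
Qed.

Lemma normr_innerH_le f g : inH rho0 f -> inH rho0 g ->
  `|innerH rho0 f g| <= normH rho0 f * normH rho0 g.
Proof.
move=> Hf Hg; rewrite ler_norml innerH_le// andbT lerNl -mulN1r -innerHZl//.
apply: le_trans (innerH_le _ _ _ Hg) _; first exact: inH_scale.
by rewrite normHZ// normrN1 mul1r.
Qed.

Lemma normHD_le f g : inH rho0 f -> inH rho0 g ->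
  normH rho0 (fadd f g) <= normH rho0 f + normH rho0 g.
Proof.
move=> Hf Hg; rewrite -ler_sqr ?nnegrE ?addr_ge0 ?normH_ge0// normHD_sqr//.
by have := innerH_le _ _ Hf Hg; nra.
Qed.

Lemma normHB_le f g : inH rho0 f -> inH rho0 g ->
  normH rho0 (fsub f g) <= normH rho0 f + normH rho0 g.
Proof.
move=> Hf Hg; rewrite fsubE; apply: le_trans (normHD_le _ _ Hf _) _.
  exact: inH_scale.
by rewrite normHZ// normrN1 mul1r.
Qed.

Lemma normH_subC f g : inH rho0 f -> inH rho0 g ->
  normH rho0 (fsub f g) = normH rho0 (fsub g f).
Proof.
move=> Hf Hg.
rewrite (_ : fsub f g = fscale (-1) (fsub g f)).
  by rewrite normHZ ?normrN1 ?mul1r//; exact: inH_sub.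
by map_ring.
Qed.

Lemma normH_triangle f g h : inH rho0 f -> inH rho0 g -> inH rho0 h ->
  normH rho0 (fsub f h) <= normH rho0 (fsub f g) + normH rho0 (fsub g h).
Proof.
move=> Hf Hg Hh.
rewrite (_ : fsub f h = fadd (fsub f g) (fsub g h)).
  by apply: normHD_le; exact: inH_sub.
by map_ring.
Qed.

End SemiInnerProduct.

(** * Lipschitz gradients, minimizers of the scheme, and curves in H *)

Section GradientsAndCurves.
Context {R : realType} {dim : nat} (rho0 : probability (dim.-tuple R) R).
Implicit Types (x y z : dim.-tuple R) (f g h : dim.-tuple R -> dim.-tuple R).
Implicit Types (F : (dim.-tuple R -> dim.-tuple R) -> R)
  (G : (dim.-tuple R -> dim.-tuple R) -> (dim.-tuple R -> dim.-tuple R)).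
Implicit Types Y V : R -> (dim.-tuple R -> dim.-tuple R).

(* The quotients only see pairs at positive distance; two maps at distance 0
   are compared through a third one at a small positive distance from both. *)
Lemma normH_lipL_le G f g : (forall xi, inH rho0 xi -> inH rho0 (G xi)) ->
  has_ubound (lip_quotients rho0 G) -> 0 < lipL rho0 G ->
  inH rho0 f -> inH rho0 g ->
  normH rho0 (fsub (G f) (G g)) <= lipL rho0 G * normH rho0 (fsub f g).
Proof.
move=> HG ubG L0 Hf Hg; set L := lipL rho0 G.
have lip u v : inH rho0 u -> inH rho0 v -> normH rho0 (fsub u v) != 0 ->
    normH rho0 (fsub (G u) (G v)) <= L * normH rho0 (fsub u v).
  move=> Hu Hv uv0; rewrite -ler_pdivrMr; last by rewrite lt0r uv0 normH_ge0.
  by apply: ub_le_sup => //; exists u, v.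
have [fg0|] := eqVneq (normH rho0 (fsub f g)) 0; last exact: lip.
(* The supremum of the empty set is 0, so [L0] provides a pair at positive distance. *)
have [_ [a [b [Ha Hb ab0 _]]]] : lip_quotients rho0 G !=set0.
  apply/set0P/eqP => q0; move: L0.
  by rewrite /lipL q0 sup0 ltxx.
have Hab := inH_sub _ _ _ Ha Hb; set c := normH rho0 _ in ab0.
have c0 : 0 < c by rewrite lt0r ab0 normH_ge0.
rewrite fg0 mulr0; apply/ler_addgt0Pr => e e0; rewrite add0r.
have Lc0 : 0 < 2 * (L * c) by rewrite !mulr_gt0.
(* The two legs through [k] cost [L * (r * c)] each, hence [e] together. *)
pose r := e / (2 * (L * c)); have r0 : 0 < r by rewrite divr_gt0.
pose k := fadd f (fscale r (fsub a b)).
have Hk : inH rho0 k by exact: inH_add _ _ _ Hf (inH_scale _ _ _ Hab).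
have kf : normH rho0 (fsub k f) = r * c.
  rewrite (_ : fsub k f = fscale r (fsub a b)); last by rewrite /k; map_ring.
  by rewrite normHZ// gtr0_norm.
have fk : normH rho0 (fsub f k) = r * c by rewrite normH_subC.
have kg : normH rho0 (fsub k g) = r * c.
  apply/eqP; rewrite eq_le; apply/andP; split.
    by have := normH_triangle _ _ _ _ Hk Hf Hg; rewrite kf fg0 addr0.
  have := normH_triangle _ _ _ _ Hk Hg Hf.
  by rewrite kf (normH_subC _ _ _ Hg Hf) fg0 addr0.
have rc0 : r * c != 0 by rewrite mulf_neq0 ?gt_eqF.
have := lip _ _ Hf Hk; have := lip _ _ Hk Hg.
rewrite fk kg => /(_ rc0) lkg /(_ rc0) lfk.
apply: le_trans (normH_triangle _ _ _ _ (HG _ Hf) (HG _ Hk) (HG _ Hg)) _.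
apply: le_trans (lerD lfk lkg) _.
rewrite le_eqVlt; apply/orP; left; apply/eqP.
by rewrite /r; field; rewrite !gt_eqF.
Qed.

(** The map in the conclusion is the gradient [g] of the objective at [f]; if its norm [N] were
    positive, a short step [- s g] would lower the objective. *)
Lemma trap_obj_min_critical F G tau f0 f : is_gradH rho0 F G -> 0 < tau ->
  inH rho0 f0 -> inH rho0 f ->
  (forall g, inH rho0 g ->
     trap_obj rho0 F G tau f0 f <= trap_obj rho0 F G tau f0 g) ->
  normH rho0 (fadd (fscale 2^-1 (fadd (G f) (G f0)))
                   (fscale tau^-1 (fsub f f0))) = 0.
Proof.
move=> gradG tau0 Hf0 Hf fmin; have [HG0 _] := gradG _ Hf0.
have [HG dF] := gradG _ Hf.
set g := fadd _ _; set N := normH rho0 g.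
have HGG : inH rho0 (fadd (G f) (G f0)) by exact: inH_add.
have Hff0 : inH rho0 (fsub f f0) by exact: inH_sub.
have Hg : inH rho0 g by apply: inH_add; exact: inH_scale.
apply/eqP/negPn/negP => N_neq0.
have N0 : 0 < N by rewrite lt0r N_neq0 normH_ge0.
(* The linear part changes the objective by [- s N^2]. The error in [F], halved, and the quadratic
   term, thanks to [s <= tau / 2], add at most [s N^2 / 4] each. *)
have [delta delta0 {}dF] := dF (N / 2) (divr_gt0 N0 (ltr0n _ 2)).
pose s := Num.min (delta / (2 * N)) (tau / 2).
have s0 : 0 < s by rewrite lt_min !divr_gt0// mulr_gt0.
have s_delta : s * N < delta.
  apply: (@le_lt_trans _ _ (delta / 2)); last by lra.
  rewrite -ler_pdivlMr// -mulrA -invfM.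
  by rewrite ge_min lexx.
have s_tau : s * tau^-1 <= 2^-1.
  by rewrite ler_pdivrMr// mulrC ge_min lexx orbT.
pose h := fscale (- s) g.
have Hh : inH rho0 h by exact: inH_scale.
have Nh : normH rho0 h = s * N by rewrite normHZ// normrN gtr0_norm.
have gh : innerH rho0 g h = - (s * N ^+ 2).
  by rewrite innerHC innerHZl// -normH_sqr mulNr.
pose q := innerH rho0 (G f) h; pose r := innerH rho0 (G f0) h.
pose p := innerH rho0 (fsub f f0) h.
have ghE : 2^-1 * (q + r) + tau^-1 * p = - (s * N ^+ 2).
  rewrite -gh (innerHDl _ _ _ _ (inH_scale _ _ _ HGG) (inH_scale _ _ _ Hff0) Hh).
  rewrite (innerHZl _ _ _ _ HGG Hh) (innerHZl _ _ _ _ Hff0 Hh).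
  by rewrite (innerHDl _ _ _ _ HG HG0 Hh).
have := dF _ Hh; rewrite Nh => /(_ s_delta).
rewrite -/q ler_norml => /andP[_ dFh].
have := fmin _ (inH_add _ _ _ Hf Hh); rewrite /trap_obj.
rewrite (innerHC _ _ (fadd f h)) innerHDl// (innerHC _ h) -/r (innerHC _ f).
rewrite (_ : fsub (fadd f h) f0 = fadd (fsub f f0) h); last by map_ring.
rewrite normHD_sqr// Nh -/p invfM => objE.
have sN0 : 0 < s * N ^+ 2 by rewrite mulr_gt0// exprn_gt0.
have := ler_wpM2l (ltW sN0) s_tau => sNs.
by lra.
Qed.

(** * Mean value inequality for curves in H *)

Section MeanValue.
Variables (a b : R) (D : set R) (Y V : R -> (dim.-tuple R -> dim.-tuple R)).
Hypothesis ab : a < b.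
Hypothesis abD : forall t, a <= t <= b -> D t.
Hypothesis HY : forall t, a <= t <= b -> inH rho0 (Y t).
Hypothesis HV : forall t, a <= t <= b -> inH rho0 (V t).
Hypothesis dY : forall t, a <= t <= b -> derivH_within rho0 D Y V t.

Lemma innerH_derivH w t eps : inH rho0 w -> a <= t <= b -> 0 < eps ->
  exists2 delta : R, 0 < delta & forall s, a <= s <= b -> `|s - t| < delta ->
    `|innerH rho0 (Y s) w - innerH rho0 (Y t) w - (s - t) * innerH rho0 (V t) w|
    <= eps * `|s - t|.
Proof.
move=> Hw tab eps0; set N := normH rho0 w.
have N0 : 0 < N + 1 by rewrite ltr_wpDl// normH_ge0.
(* [N + 1] in place of [N] also covers a [w] of norm 0. *)
have [delta delta0 dYt] := dY _ tab (eps / (N + 1)) (divr_gt0 eps0 N0).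
exists delta => // s sab st.
have [->|s_neq_t] := eqVneq s t.
  by rewrite !subrr mul0r subrr !normr0 mulr0.
have := dYt s (abD _ sab); rewrite st andbT normr_gt0 subr_eq0 => /(_ s_neq_t).
have HYs := HY _ sab; have HYt := HY _ tab; have HVt := HV _ tab.
have HYB := inH_sub _ _ _ HYs HYt.
have HVZ := inH_scale _ (s - t) _ HVt.
move=> YVle; rewrite -innerHZl// -!innerHBl//.
apply: le_trans (normr_innerH_le _ _ _ (inH_sub _ _ _ HYB HVZ) Hw) _.
apply: le_trans (ler_wpM2r (normH_ge0 _ _) YVle) _.
rewrite -/N mulrAC ler_wpM2r// -mulrA ler_piMr ?(ltW eps0)//.
by rewrite mulrC ler_pdivrMr// mul1r lerDl.
Qed.

Lemma is_derive_innerH w t : inH rho0 w -> t \in `]a, b[ ->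
  is_derive t 1 (fun s => innerH rho0 (Y s) w) (innerH rho0 (V t) w).
Proof.
move=> Hw; rewrite in_itv/= => /andP[a_t t_b].
set f := fun s => _; set l := innerH _ _ _.
have fl : h^-1 *: ((f \o shift t) (h *: (1 : R)) - f t) @[h --> 0^'] --> l.
  apply/cvgrPdist_le => eps eps0.
  have [delta delta0 fd] := innerH_derivH w t eps Hw (andb_true_intro
    (conj (ltW a_t) (ltW t_b))) eps0.
  near=> h.
  have h0 : h != 0 by near: h; exact: nbhs_dnbhs_neq.
  have hd : `|h| < delta by near: h; exact: dnbhs0_lt.
  have hab : `|h| < Num.min (t - a) (b - t).
    by near: h; apply: dnbhs0_lt; rewrite lt_min !subr_gt0 a_t.
  move: hab; rewrite lt_min !ltr_norml => /andP[/andP[h1 h2] /andP[h3 h4]].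
  have := fd (h + t); rewrite addrK => /(_ _ hd) fdh.
  rewrite /= [h *: 1]mulr1 distrC -(ler_pM2r (x := `|h|)) ?normr_gt0//.
  rewrite -normrM mulrBl [_ *: _]mulrC mulfVK// (mulrC l).
  by apply: fdh; apply/andP; split; lra.
by apply: DeriveDef; [apply/cvg_ex; exists l|exact: cvg_lim].
Unshelve. all: by end_near.
Qed.

(** The mean value theorem asks for continuity up to the end points. The first-order expansion with
    error constant 1 bounds increments near [t] by [K * |s - t|]. *)
Lemma within_continuous_innerH w : inH rho0 w ->
  {within `[a, b], continuous (fun s => innerH rho0 (Y s) w)}.
Proof.
move=> Hw; apply/subspace_continuousP => t; rewrite /= in_itv/= => tab.
apply/cvgrPdist_le => eps eps0.
have [delta delta0 fd] := innerH_derivH w t 1 Hw tab ltr01.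
set l := innerH rho0 (V t) w in fd; pose K := 1 + `|l|.
have K0 : 0 < K by rewrite ltr_wpDr.
apply/nbhs_ballP; exists (Num.min delta (eps / K)) => /=.
  by rewrite lt_min delta0 divr_gt0.
move=> s; rewrite /ball/= lt_min distrC => /andP[sd sK] sab.
rewrite in_itv/= in sab.
have := fd s sab sd; set u := innerH rho0 _ _; set v := innerH rho0 _ _.
move=> uvl; rewrite distrC.
have -> : u - v = (u - v - (s - t) * l) + (s - t) * l by rewrite subrK.
apply: le_trans (ler_normD _ _) _; apply: le_trans (lerD uvl (lexx _)) _.
rewrite normrM (mulrC `|s - t|) -mulrDl -/K mulrC -ler_pdivlMr//.
exact: ltW.
Qed.

(* The scalar mean value theorem is applied to the component of [Y] along
   [Y b - Y a]. *)
Lemma normH_mean_value_le C :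
  (forall t, a <= t <= b -> normH rho0 (V t) <= C) ->
  normH rho0 (fsub (Y b) (Y a)) <= C * (b - a).
Proof.
move=> VC.
have aab : a <= a <= b by rewrite lexx ltW.
have bab : a <= b <= b by rewrite lexx ltW.
have HYa := HY _ aab; have HYb := HY _ bab.
set w := fsub (Y b) (Y a); have Hw : inH rho0 w by exact: inH_sub.
have [c cab] := @MVT R (fun s => innerH rho0 (Y s) w)
  (fun s => innerH rho0 (V s) w) a b ab
  (fun t => is_derive_innerH w t Hw) (within_continuous_innerH w Hw).
rewrite -innerHBl// -/w -normH_sqr.
have {}cab : a <= c <= b by move: cab; rewrite in_itv/= => /andP[/ltW-> /ltW->].
set N := normH rho0 w => NE.
have [->|N_neq0] := eqVneq N 0.
  rewrite mulr_ge0 ?subr_ge0 ?(ltW ab)//.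
  exact: le_trans (normH_ge0 _ _) (VC _ cab).
have N0 : 0 < N by rewrite lt0r N_neq0 normH_ge0.
(* [NE] reads [N^2 = <V c, w> (b - a)]; Cauchy-Schwarz bounds this by [C N (b - a)], and [N]
   cancels. *)
rewrite -(ler_pM2r N0) -expr2 NE mulrAC ler_wpM2r ?subr_ge0 ?(ltW ab)//.
apply: le_trans (innerH_le _ _ _ (HV _ cab) Hw) _.
by rewrite ler_wpM2r ?normH_ge0 ?VC.
Qed.

End MeanValue.

Lemma derivH_within_taylor2 D Y V t0 v w t :
  (forall s, D s -> inH rho0 (Y s)) -> D t -> inH rho0 (V t) ->
  inH rho0 v -> inH rho0 w ->
  derivH_within rho0 D Y V t ->
  derivH_within rho0 D
    (fun s => fsub (fsub (Y s) (fscale (s - t0) v))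
                   (fscale ((s - t0) ^+ 2 / 2) w))
    (fun s => fsub (fsub (V s) v) (fscale (s - t0) w)) t.
Proof.
move=> HY Dt HV Hv Hw dY eps eps0.
have [delta delta0 {}dY] := dY _ (divr_gt0 eps0 (ltr0n _ 2)).
pose N := normH rho0 w + 1.
have N0 : 0 < N by rewrite ltr_wpDl// normH_ge0.
exists (Num.min delta (eps / N)); first by rewrite lt_min delta0 divr_gt0.
move=> s Ds; rewrite lt_min => /andP[st0 /andP[std stN]].
have := dY s Ds; rewrite st0 std => /(_ isT) dYs.
set u := fsub (fsub (Y s) (Y t)) (fscale (s - t) (V t)) in dYs.
(* The first-order remainder at [t] of [(s - t0)^2 / 2] is [(s - t)^2 / 2], whatever [t0]; it gets
   the second half of [eps]. *)
rewrite (_ : fsub _ _ = fsub u (fscale ((s - t) ^+ 2 / 2) w)); last first.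
  rewrite /u; apply/funext => x; apply: eq_from_tnth => i.
  by rewrite !tnth_mapE; field.
have Hu : inH rho0 u.
  apply: inH_sub; last exact: inH_scale.
  by apply: inH_sub; exact: HY.
apply: le_trans (normHB_le _ _ _ Hu (inH_scale _ _ _ Hw)) _.
rewrite normHZ// normrM normrX (@ger0_norm _ 2^-1)//.
have stN' : `|s - t| * normH rho0 w <= eps.
  apply: (@le_trans _ _ (`|s - t| * N)); first by rewrite ler_wpM2l ?lerDl.
  by rewrite -ler_pdivlMr// ltW.
have := ler_wpM2l (ltW st0) stN'; lra.
Qed.

(** The Taylor remainder [Z] has velocity at most [C], and velocity zero at [t]. Its increment
    contributes [C tau] and the trapezoidal term at [t + tau] half as much, whence [3 / 2]. *)
Lemma normH_trapezoid_defect_le D Y V w t tau C : 0 < tau ->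
  (forall s, D s -> inH rho0 (Y s)) -> (forall s, t <= s <= t + tau -> D s) ->
  (forall s, t <= s <= t + tau -> inH rho0 (V s)) -> inH rho0 w ->
  (forall s, t <= s <= t + tau -> derivH_within rho0 D Y V s) ->
  (forall s, t <= s <= t + tau ->
     normH rho0 (fsub (fsub (V s) (V t)) (fscale (s - t) w)) <= C) ->
  normH rho0 (fsub (fsub (Y (t + tau)) (Y t))
    (fscale (tau / 2) (fadd (V t) (V (t + tau))))) <= 3 / 2 * (C * tau).
Proof.
move=> tau0 HY tD HV Hw dY VC.
have tle : t <= t + tau by rewrite lerDl ltW.
have tt : t <= t <= t + tau by rewrite lexx.
have tT : t <= t + tau <= t + tau by rewrite lexx andbT.
pose Z s := fsub (fsub (Y s) (fscale (s - t) (V t)))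
                 (fscale ((s - t) ^+ 2 / 2) w).
have HZ s : D s -> inH rho0 (Z s).
  move=> Ds; apply: inH_sub; last exact: inH_scale.
  by apply: inH_sub; [exact: HY|apply: inH_scale; exact: HV].
have HU s : t <= s <= t + tau ->
    inH rho0 (fsub (fsub (V s) (V t)) (fscale (s - t) w)).
  move=> ts; apply: inH_sub; last exact: inH_scale.
  by apply: inH_sub; exact: HV.
have ZC : normH rho0 (fsub (Z (t + tau)) (Z t)) <= C * tau.
  have tauE : t + tau - t = tau by rewrite addrAC subrr add0r.
  rewrite -[X in C * X]tauE; apply: (@normH_mean_value_le t (t + tau) D Z
    (fun s => fsub (fsub (V s) (V t)) (fscale (s - t) w))) => [|||||s ts].
  - by rewrite ltrDl.
  - exact: tD.
  - by move=> s ts; apply: HZ; exact: tD.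
  - exact: HU.
  - by move=> s ts; apply: derivH_within_taylor2; auto.
  - exact: VC.
set U := fsub (fsub (V (t + tau)) (V t)) (fscale (t + tau - t) w).
have HUT : inH rho0 U by exact: HU.
(* The trapezoidal rule is exact on quadratic polynomials, so [Y] and [Z] have the same defect. *)
rewrite (_ : fsub _ _ =
    fsub (fsub (Z (t + tau)) (Z t)) (fscale (tau / 2) U)); last first.
  rewrite /Z /U; apply/funext => x; apply: eq_from_tnth => i.
  by rewrite !tnth_mapE; field.
have HZZ : inH rho0 (fsub (Z (t + tau)) (Z t)).
  by apply: inH_sub; apply: HZ; exact: tD.
apply: le_trans (normHB_le _ _ _ HZZ (inH_scale _ _ _ HUT)) _.
rewrite normHZ// ger0_norm ?divr_ge0 ?(ltW tau0)//.
have := ler_wpM2l (ltW tau0) (VC _ tT); move: ZC.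
rewrite -/U; generalize (normH rho0 U) => n.
by generalize (normH rho0 (fsub (Z (t + tau)) (Z t))) => m; lra.
Qed.
End GradientsAndCurves.

(** * Discrete Gronwall inequality and error propagation over one step *)

Lemma trapezoid_gronwall (R : realType) (e : nat -> R) (a d : R) (N : nat) :
  0 < a <= 1 -> 0 <= d -> (forall n, 0 <= e n) ->
  (forall n, (n < N)%N -> e n.+1 <= e n + a / 2 * (e n + e n.+1) + d) ->
  forall n, (n <= N)%N ->
  e n <= (1 + 2 * a) ^+ n * e 0%N + d / a * ((1 + 2 * a) ^+ n - 1).
Proof.
move=> /andP[a0 a1] d0 e0 he; elim=> [_|n IHn nN].
  by rewrite expr0 subrr mulr0 addr0 mul1r.
have step : e n.+1 <= (1 + 2 * a) * e n + 2 * d.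
  have en := e0 n.
  have c0 : 0 < 1 - a / 2 by lra.
  rewrite -(ler_pM2l c0); apply: (@le_trans _ _ ((1 + a / 2) * e n + d)).
    have := he _ nN; lra.
  (* [(1 - a / 2) (1 + 2 a) - (1 + a / 2) = a (1 - a)] and [2 (1 - a / 2) - 1 = 1 - a]; both are
     nonnegative since [a <= 1]. *)
  have : 0 <= a * (1 - a) * e n by rewrite mulr_ge0// mulr_ge0 ?(ltW a0)//; lra.
  have : 0 <= (1 - a) * d by rewrite mulr_ge0//; lra.
  lra.
apply: le_trans step _.
have c0 : 0 <= 1 + 2 * a by lra.
have := ler_wpM2l c0 (IHn (ltnW nN)).
have : d / a * a = d by rewrite divfK// gt_eqF.
rewrite exprS; move: (d / a) => r <-; lra.
Qed.

(** Here [u], [u'] are consecutive iterates and [v], [v'] the exact solution at the matching times;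
    subtracting the two trapezoidal rules leaves gradient differences and the defect. *)
Lemma normH_trap_step_le (R : realType) (dim : nat)
  (rho0 : probability (dim.-tuple R) R)
  (G : (dim.-tuple R -> dim.-tuple R) -> (dim.-tuple R -> dim.-tuple R))
  (u u' v v' : dim.-tuple R -> dim.-tuple R) (L tau d : R) : 0 < tau ->
  (forall f, inH rho0 f -> inH rho0 (G f)) ->
  (forall f g, inH rho0 f -> inH rho0 g ->
     normH rho0 (fsub (G f) (G g)) <= L * normH rho0 (fsub f g)) ->
  inH rho0 u -> inH rho0 u' -> inH rho0 v -> inH rho0 v' ->
  normH rho0 (fadd (fscale 2^-1 (fadd (G u') (G u)))
                   (fscale tau^-1 (fsub u' u))) = 0 ->
  normH rho0 (fsub (fsub v' v)
    (fscale (tau / 2) (fadd (fopp (G v)) (fopp (G v'))))) <= d ->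
  normH rho0 (fsub u' v') <= normH rho0 (fsub u v) +
    tau * L / 2 * (normH rho0 (fsub u v) + normH rho0 (fsub u' v')) + d.
Proof.
move=> tau0 HG lipG Hu Hu' Hv Hv'.
have HGu := HG _ Hu; have HGu' := HG _ Hu'.
have HGv := HG _ Hv; have HGv' := HG _ Hv'.
set c := fadd _ _ => c0; set D := fsub _ (fscale _ _) => Dd.
have Hc : inH rho0 c by apply: inH_add; apply: inH_scale;
  [exact: inH_add|exact: inH_sub].
have HD : inH rho0 D.
  apply: inH_sub; first exact: inH_sub.
  by apply: inH_scale; apply: inH_add; exact: inH_opp.
have HB f g : inH rho0 f -> inH rho0 g ->
    inH rho0 (fscale (tau / 2) (fsub f g)).
  by move=> Hf Hg; apply: inH_scale; exact: inH_sub.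
have Huv := inH_sub _ _ _ Hu Hv.
(* [c] has norm 0 but may be nonzero as a map; carrying it inside [w] makes [uvE] a pointwise
   identity. *)
pose w := fadd (fsub u v) (fscale tau c).
have Hw : inH rho0 w by exact: inH_add _ _ _ Huv (inH_scale _ _ _ Hc).
have Hw1 := inH_sub _ _ _ Hw (HB _ _ HGu' HGv').
have Hw2 := inH_sub _ _ _ Hw1 (HB _ _ HGu HGv).
have uvE : fsub u' v' =
    fsub (fsub (fsub w (fscale (tau / 2) (fsub (G u') (G v'))))
               (fscale (tau / 2) (fsub (G u) (G v)))) D.
  rewrite /w /D /c; apply/funext => x; apply: eq_from_tnth => i.
  by rewrite !tnth_mapE; field; rewrite gt_eqF.
rewrite {1}uvE; apply: le_trans (normHB_le _ _ _ Hw2 HD) _; apply: lerD => //.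
apply: le_trans (normHB_le _ _ _ Hw1 (HB _ _ HGu HGv)) _.
apply: le_trans (lerD (normHB_le _ _ _ Hw (HB _ _ HGu' HGv')) (lexx _)) _.
have wle : normH rho0 w <= normH rho0 (fsub u v).
  apply: le_trans (normHD_le _ _ _ Huv (inH_scale _ _ _ Hc)) _.
  by rewrite normHZ// c0 mulr0 addr0.
rewrite !normHZ; try exact: inH_sub.
have t2 : 0 <= tau / 2 by rewrite divr_ge0// ltW.
rewrite ger0_norm//.
move: wle (ler_wpM2l t2 (lipG _ _ Hu Hv)) (ler_wpM2l t2 (lipG _ _ Hu' Hv')).
generalize (normH rho0 w) (normH rho0 (fsub (G u) (G v)))
  (normH rho0 (fsub (G u') (G v'))) (normH rho0 (fsub u v))
  (normH rho0 (fsub u' v')) => *; lra.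
Qed.

Lemma normH_holder_quotient_le (R : realType) (dim : nat)
  (rho0 : probability (dim.-tuple R) R)
  (V W : R -> (dim.-tuple R -> dim.-tuple R)) (T alpha t s r : R) :
  (forall t, 0 <= t <= T -> inH rho0 (V t)) ->
  (forall t, 0 <= t <= T -> inH rho0 (W t)) ->
  has_ubound (holder_quotients rho0 T alpha V W) ->
  0 <= 1 + alpha -> 0 <= LalphaC rho0 T alpha V W ->
  0 <= t <= T -> 0 <= s <= T -> `|t - s| <= r ->
  normH rho0 (fsub (fsub (V t) (V s)) (fscale (t - s) (W s)))
  <= LalphaC rho0 T alpha V W * r `^ (1 + alpha).
Proof.
move=> HV HW ubH a0 La0 tT sT tsr.
(* The quotients leave out [t = s], where the left-hand side vanishes. *)
have [->|ts] := eqVneq t s.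
  have -> : fsub (fsub (V s) (V s)) (fscale (s - s) (W s)) = fscale 0 (W s).
    by map_ring.
  rewrite normHZ; last exact: HW.
  by rewrite normr0 mul0r mulr_ge0// powR_ge0.
apply: (@le_trans _ _ (LalphaC rho0 T alpha V W * `|t - s| `^ (1 + alpha))).
  rewrite -ler_pdivrMr; last by rewrite powR_gt0// normr_gt0 subr_eq0.
  by apply: ub_le_sup => //; exists t, s.
rewrite ler_wpM2l// ge0_ler_powR// nnegrE//.
exact: le_trans (normr_ge0 _) tsr.
Qed.

(** * Convergence of order [1 + alpha] of the scheme *)

Theorem mainTheorem1 (R : realType) (dim : nat)
  (rho0 : probability (dim.-tuple R) R)
  (phi : (set (dim.-tuple R) -> \bar R) -> R)
  (G : (dim.-tuple R -> dim.-tuple R) -> (dim.-tuple R -> dim.-tuple R))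
  (X Xdd : R -> (dim.-tuple R -> dim.-tuple R))
  (T alpha tau : R) (Xs : nat -> (dim.-tuple R -> dim.-tuple R)) :
  P2 rho0 ->
  (* G is the Frechet gradient of the philift on H *)
  is_gradH rho0 (philift rho0 phi) G ->
  (* the philift is bounded, its gradient is bounded *)
  (exists M : R, forall xi, inH rho0 xi -> `|philift rho0 phi xi| <= M) ->
  (exists M : R, forall xi, inH rho0 xi -> normH rho0 (G xi) <= M) ->
  (* the gradient is globally Lipschitz with constant L(phi) in (0, oo) *)
  has_ubound (lip_quotients rho0 G) ->
  0 < lipL rho0 G ->
  (* X is the C^1 solution of X' = - grad (X), X(0) = Id in H *)
  (forall t, 0 <= t -> inH rho0 (X t)) ->
  normH rho0 (fsub (X 0) id) = 0 ->
  (forall t, 0 <= t ->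
     derivH_within rho0 [set s | 0 <= s] X (fun s => fopp (G (X s))) t) ->
  (forall t, 0 <= t ->
     contH_within rho0 [set s | 0 <= s] (fun s => fopp (G (X s))) t) ->
  0 < T -> 0 < alpha <= 1 ->
  (* X' is differentiable on [0, T] with derivative Xdd *)
  (forall t, 0 <= t <= T -> inH rho0 (Xdd t)) ->
  (forall t, 0 <= t <= T ->
     derivH_within rho0 [set s | 0 <= s <= T] (fun s => fopp (G (X s))) Xdd t) ->
  (* L_alpha(T, Xdd) < oo *)
  has_ubound (holder_quotients rho0 T alpha (fun s => fopp (G (X s))) Xdd) ->
  0 < tau -> tau <= 1 / lipL rho0 G ->
  (* (Xs n) are the iterates of the Lagrangian trapezoidal scheme *)
  trap_iterates rho0 (philift rho0 phi) G tau Xs ->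
  forall k : nat, k%:R * tau <= T ->
    W2 (pushforward rho0 (X (k%:R * tau))) (pushforward rho0 (Xs k))
      <= normH rho0 (fsub (Xs k) (X (k%:R * tau)))
    /\ normH rho0 (fsub (Xs k) (X (k%:R * tau)))
      <= expR (2 * lipL rho0 G * T) * normH rho0 (fsub (Xs 0%N) id)
         + 2 * (LalphaC rho0 T alpha (fun s => fopp (G (X s))) Xdd / lipL rho0 G)
             * (expR (2 * lipL rho0 G * T) - 1) * tau `^ (1 + alpha).
Proof.
move=> P2rho gradG _ _ ubG L0 HX X0 dX _ T0 /andP[alpha0 _] HXdd _.
move=> ubH tau0 tauL [HXs0 Xsmin] k kT.
set L := lipL rho0 G in L0 tauL *; set V := fun s => fopp (G (X s)).
set La := LalphaC rho0 T alpha V Xdd.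
have HG f : inH rho0 f -> inH rho0 (G f) by move=> /gradG[].
have HXs n : inH rho0 (Xs n) by case: n => [//|n]; case: (Xsmin n).
have HV t : 0 <= t -> inH rho0 (V t).
  by move=> t0; apply: inH_opp; apply: HG; exact: HX.
have lipG f g : inH rho0 f -> inH rho0 g ->
    normH rho0 (fsub (G f) (G g)) <= L * normH rho0 (fsub f g).
  exact: normH_lipL_le.
have La0 : 0 <= La.
  (* A supremum is nonnegative once it dominates one nonnegative quotient; the pair [T], [0] is
     admissible since [0 < T]. *)
  pose q := normH rho0 (fsub (fsub (V T) (V 0)) (fscale (T - 0) (Xdd 0)))
    / (`|T - 0| `^ (1 + alpha)).
  apply: (@le_trans _ _ q); first by rewrite divr_ge0 ?normH_ge0 ?powR_ge0.
  by apply: ub_le_sup => //; exists T, 0; rewrite !lexx ltW// gt_eqF.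
have kt0 n : 0 <= n%:R * tau by rewrite mulr_ge0// ltW.
split.
  have HXk := HX _ (kt0 k).
  by rewrite (normH_subC _ (Xs k))//; exact: W2_pushforward_le.
pose C := La * tau `^ (1 + alpha).
have C0 : 0 <= C by rewrite mulr_ge0 ?powR_ge0.
pose e n := normH rho0 (fsub (Xs n) (X (n%:R * tau))).
(* Only steps before [k] are compared: they end by time [k tau <= T], where the Hölder bound is
   available. *)
have step n : (n < k)%N ->
    e n.+1 <= e n + tau * L / 2 * (e n + e n.+1) + 3 / 2 * (C * tau).
  move=> nk; set t := n%:R * tau.
  have tS : n.+1%:R * tau = t + tau by rewrite -natr1 mulrDl mul1r.
  have tT : t + tau <= T.
    by rewrite -tS; apply: le_trans kT; rewrite ler_wpM2r ?ler_nat ?(ltW tau0).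
  have t0 : 0 <= t := kt0 n.
  rewrite /e tS -/t; apply: (@normH_trap_step_le _ _ _ G _ _ _ _ L _ _ tau0 HG lipG).
  - exact: HXs.
  - exact: HXs.
  - exact: HX.
  - by apply: HX; rewrite addr_ge0// ltW.
  - have [_ nmin] := Xsmin n.
    exact: (@trap_obj_min_critical _ _ _ (philift rho0 phi)).
  apply: (@normH_trapezoid_defect_le _ _ _ [set s | 0 <= s] X V (Xdd t)) => //.
  - by move=> s /andP[/(le_trans t0)].
  - by move=> s /andP[/(le_trans t0) s0 _]; exact: HV.
  - by apply: HXdd; rewrite t0 (le_trans _ tT)// lerDl ltW.
  - by move=> s /andP[/(le_trans t0) s0 _]; exact: dX.
  move=> s /andP[ts st]; apply: normH_holder_quotient_le => //.
  - by move=> r /andP[r0 _]; exact: HV.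
  - by rewrite addr_ge0// ltW.
  - by rewrite (le_trans t0 ts) (le_trans st tT).
  - by rewrite t0 (le_trans _ tT)// lerDl ltW.
  - by rewrite ger0_norm ?subr_ge0// lerBlDl.
have a01 : 0 < tau * L <= 1 by rewrite mulr_gt0//= -ler_pdivlMr.
have d0 : 0 <= 3 / 2 * (C * tau) by rewrite mulr_ge0// mulr_ge0// ltW.
have e_ge0 n : 0 <= e n by exact: normH_ge0.
have := trapezoid_gronwall _ e _ _ k a01 d0 e_ge0 step k (leqnn k).
set q := _ ^+ k => ek; apply: le_trans ek _.
have q1 : 1 <= q by rewrite exprn_ege1// lerDl mulr_ge0// ltW; case/andP: a01.
(* [1 + 2 a <= exp (2 a)] with [a = tau L], and [k tau <= T]. *)
have qE : q <= expR (2 * L * T).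
  apply: (@le_trans _ _ (expR (2 * (tau * L)) ^+ k)).
    rewrite lerXn2r ?nnegrE ?expR_ge0 ?expR_ge1Dx// addr_ge0// mulr_ge0// ltW//.
    by case/andP: a01.
  rewrite -expRM_natl ler_expR.
  have := ler_wpM2l (ltW L0) kT; lra.
(* [X 0] agrees with the identity only up to a map of norm 0, hence the triangle inequality. *)
have e0E : e 0%N <= normH rho0 (fsub (Xs 0%N) id).
  rewrite /e mul0r.
  have Hid := inH_id _ P2rho.
  apply: le_trans (normH_triangle _ _ _ _ (HXs 0%N) Hid (HX _ (lexx 0))) _.
  by rewrite (normH_subC _ id)// ?X0 ?addr0//; exact: HX.
apply: lerD; first by apply: ler_pM => //; rewrite (le_trans ler01).
(* The Gronwall quotient [d / a]; its factor [3 / 2] is then relaxed to 2. *)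
have -> : 3 / 2 * (C * tau) / (tau * L) = 3 / 2 * (La / L) * tau `^ (1 + alpha).
  by rewrite /C; field; rewrite !gt_eqF.
rewrite mulrAC ler_wpM2r ?powR_ge0//.
have LaL : 0 <= La / L by rewrite divr_ge0// ltW.
by apply: ler_pM; [rewrite mulr_ge0|rewrite subr_ge0|rewrite ler_wpM2r//; lra|
   rewrite lerD2r].
Qed.
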